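(* Let $p=2$, $\theta\in\mathcal{E}_2$, $q\in\mathbb{Q}_2$ with $0<|\theta-1|_2<|q|_2<1$, and $f=f_{\theta,q,3}$. Then $$\mathfrak{B}(\mathbf{x}^{(0)})=\mathbb{Q}_2\setminus\left(\{\mathbf{x}^{(1)}\}\cup\bigcup_{n=0}^{+\infty}f^{-n}\{\mathbf{x}^{(\infty)}\}\right).$$
   Context: $\mathcal{E}_2=\{x\in\mathbb{Q}_2:|x-1|_2<\frac12\}$. The Potts--Bethe mapping is $f_{\theta,q,3}(x)=\left(\frac{\theta x+q-1}{x+\theta+q-2}\right)^3$, defined on $\mathbb{Q}_2\setminus\{\mathbf{x}^{(\infty)}\}$, $\mathbf{x}^{(\infty)}=2-\theta-q$. For $S\subset\mathbb{Q}_2$, $n\ge0$, $f^{-n}(S)$ is the set of $x$ for which the iterate $f^n(x)$ is defined and lies in $S$ ($f^0$ the identity). $\mathbf{x}^{(0)}=1$ is a fixed point. The cubic $y^3-(1+\theta+\theta^2)y^2-(2\theta+1)(1-\theta-q)y-(1-\theta-q)^2=0$ has exactly one root $\mathbf{y}^{(1)}\in\mathbb{Q}_2$, and $\mathbf{x}^{(1)}=1-q+(\theta-1)(\mathbf{y}^{(1)}-1)$ is the other fixed point of $f$. $\mathfrak{B}(\mathbf{x}^{(0)})=\{x\in\mathbb{Q}_2:\lim_{n\to\infty}f^n(x)=\mathbf{x}^{(0)}\}$ (all iterates defined). *)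

(* Defs.v *)
From HB Require Import structures.
From mathcomp Require Import all_boot all_order all_algebra.
From mathcomp Require Import ring lra zify.
From mathcomp Require Import boolp classical_sets functions topology.

Set Implicit Arguments.
Unset Strict Implicit.
Unset Printing Implicit Defensive.

Import Order.TTheory GRing.Theory Num.Theory.
Local Open Scope ring_scope.
Local Open Scope quotient_scope.

Section RatNorm.
Variable p : nat.
Implicit Types x y : rat.

Definition ratval x : int := (logn p `|numq x|)%:Z - (logn p `|denq x|)%:Z.

Definition ratnorm x : rat := if x == 0 then 0 else p%:R ^ (- ratval x).

Hypothesis p_pr : prime p.

Let p_gt0 : 0 < p%:R :> rat. Proof. by rewrite ltr0n prime_gt0. Qed.
Let p_neq0 : p%:R != 0 :> rat. Proof. by rewrite gt_eqF. Qed.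

Lemma ratnorm0 : ratnorm 0 = 0. Proof. by rewrite /ratnorm eqxx. Qed.

Lemma ratnorm_ge0 x : 0 <= ratnorm x.
Proof. by rewrite /ratnorm; case: ifP => // _; apply/exprz_ge0/ltW. Qed.

Lemma ratnorm_eq0 x : (ratnorm x == 0) = (x == 0).
Proof.
rewrite /ratnorm; case: ifP => [|_]; first by rewrite eqxx.
by rewrite expfz_eq0 (negPf p_neq0) andbF.
Qed.

Lemma ratval_frac (a b : int) : a != 0 -> b != 0 ->
  ratval (a%:~R / b%:~R) = (logn p `|a|)%:Z - (logn p `|b|)%:Z.
Proof.
move=> a0 b0; rewrite /ratval; set x : rat := _ / _.
have b0' : b%:~R != 0 :> rat by rewrite intr_eq0.
have x0 : x != 0 by rewrite mulf_neq0 ?invr_eq0 ?intr_eq0.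
have e : numq x * b = a * denq x.
  apply: (@intr_inj rat); rewrite !rmorphM /= numqE /x.
  by rewrite mulrAC divfK // mulrC.
have {}e : (`|numq x| * `|b| = `|a| * `|denq x|)%N by rewrite -!abszM e.
have /(congr1 (logn p)) := e.
rewrite !lognM ?absz_gt0 ?numq_eq0 ?denq_neq0 //; lia.
Qed.

Lemma ratnormM x y : ratnorm (x * y) = ratnorm x * ratnorm y.
Proof.
have [->|x0] := eqVneq x 0; first by rewrite !(mul0r, ratnorm0).
have [->|y0] := eqVneq y 0; first by rewrite !(mulr0, ratnorm0).
rewrite /ratnorm mulf_eq0 (negPf x0) (negPf y0) /= -expfzDr //; congr (_ ^ _).
have -> : x * y = (numq x * numq y)%:~R / (denq x * denq y)%:~R.
  by rewrite -{1}(divq_num_den x) -{1}(divq_num_den y) mulf_div !rmorphM.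
rewrite ratval_frac ?mulf_neq0 ?numq_eq0 ?denq_neq0 // /ratval !abszM.
rewrite !lognM ?absz_gt0 ?numq_eq0 ?denq_neq0 //; lia.
Qed.

Lemma ratnorm1 : ratnorm 1 = 1.
Proof.
have /eqP := ratnormM 1 1; rewrite mul1r -{1}[ratnorm 1]mulr1 eq_sym.
rewrite -subr_eq0 -mulrBr mulf_eq0 ratnorm_eq0 oner_eq0 /= subr_eq0.
by move=> /eqP.
Qed.

Lemma ratnormN x : ratnorm (- x) = ratnorm x.
Proof. by rewrite /ratnorm oppr_eq0 /ratval numqN denqN abszN. Qed.

Lemma ratnormV x : ratnorm x^-1 = (ratnorm x)^-1.
Proof.
have [->|x0] := eqVneq x 0; first by rewrite !(invr0, ratnorm0).
apply: (@mulfI _ (ratnorm x)); first by rewrite ratnorm_eq0.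
by rewrite -ratnormM !divff ?ratnorm_eq0 // ratnorm1.
Qed.

Lemma ratnormD x y : ratnorm (x + y) <= Num.max (ratnorm x) (ratnorm y).
Proof.
have [->|x0] := eqVneq x 0; first by rewrite add0r le_max lexx orbT.
have [->|y0] := eqVneq y 0; first by rewrite addr0 le_max lexx.
have [->|s0] := eqVneq (x + y) 0; first by rewrite ratnorm0 le_max !ratnorm_ge0.
rewrite {1}/ratnorm (negPf s0).
pose a : int := numq x * denq y; pose b : int := numq y * denq x.
pose d : int := denq x * denq y.
have d0 : d != 0 by rewrite mulf_neq0 ?denq_neq0.
have a0 : a != 0 by rewrite mulf_neq0 ?numq_eq0 ?denq_neq0.
have b0 : b != 0 by rewrite mulf_neq0 ?numq_eq0 ?denq_neq0.
have dx : (denq x)%:~R != 0 :> rat by rewrite intr_eq0 denq_neq0.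
have dy : (denq y)%:~R != 0 :> rat by rewrite intr_eq0 denq_neq0.
have ex : x = a%:~R / d%:~R.
  rewrite -{1}(divq_num_den x) /a /d !rmorphM /=; field.
  by rewrite dx dy.
have ey : y = b%:~R / d%:~R.
  rewrite -{1}(divq_num_den y) /b /d !rmorphM /=; field.
  by rewrite dx dy.
have es : x + y = (a + b)%:~R / d%:~R by rewrite rmorphD mulrDl -ex -ey.
have s0' : a + b != 0.
  by apply: contraNneq s0; rewrite es => ->; rewrite mul0r.
have hv : (minn (logn p `|a|) (logn p `|b|) <= logn p `|(a + b)%R|)%N.
  rewrite -pfactor_dvdn ?absz_gt0 //.
  have: (Posz (p ^ minn (logn p `|a|) (logn p `|b|))%N %| a + b)%Z.
    rewrite rpredD // !dvdzE /= pfactor_dvdn ?absz_gt0 // ?geq_minl ?geq_minr //.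
  by rewrite dvdzE.
have p1 : 1 < p%:R :> rat by rewrite ltr1n prime_gt1.
rewrite /ratnorm (negPf x0) (negPf y0) le_max !ler_eXz2l //.
rewrite es ex ey !ratval_frac //; lia.
Qed.

Lemma ratnorm_lt e x y : ratnorm x < e -> ratnorm y < e -> ratnorm (x + y) < e.
Proof. by move=> hx hy; apply: le_lt_trans (ratnormD x y) _; rewrite gt_max hx. Qed.

Lemma ratnorm_distC x y : ratnorm (x - y) = ratnorm (y - x).
Proof. by rewrite -opprB ratnormN. Qed.

(* In an ultrametric space, a perturbation smaller than x leaves |x| unchanged. *)
Lemma ratnorm_stable x y : ratnorm (x - y) < ratnorm x -> ratnorm y = ratnorm x.
Proof.
move=> h; apply/eqP; rewrite eq_le; apply/andP; split.
  have := ratnormD (y - x) x; rewrite subrK => /le_trans; apply.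
  by rewrite ge_max lexx ratnorm_distC ltW.
have := ratnormD (x - y) y; rewrite subrK le_max => /orP[|//].
by rewrite leNgt h.
Qed.

End RatNorm.

Section Cauchy.
Variables (p : nat) (p_pr : prime p).
Local Notation nm := (ratnorm p).
Implicit Types x y : nat -> rat.

Definition padic_cauchy x := forall e : rat, 0 < e ->
  exists N, forall m n, (N <= m)%N -> (N <= n)%N -> nm (x m - x n) < e.

Definition padic_null x := forall e : rat, 0 < e ->
  exists N, forall n, (N <= n)%N -> nm (x n) < e.

Lemma padic_cauchy_bounded x : padic_cauchy x ->
  exists2 M, 0 < M & forall n, nm (x n) <= M.
Proof.
move=> /(_ 1 ltr01)[N hN].
exists (\sum_(i < N) nm (x i) + nm (x N) + 1).
  by apply: ltr_wpDl => //; apply: addr_ge0; rewrite ?sumr_ge0 // => *;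
    exact: ratnorm_ge0.
move=> n; have [ltnN|leNn] := ltnP n N.
  rewrite (bigD1 (Ordinal ltnN)) //= -!addrA lerDl.
  by rewrite !addr_ge0 ?sumr_ge0 // => *; exact: ratnorm_ge0.
have := ratnormD p_pr (x n - x N) (x N); rewrite subrK => /le_trans; apply.
have s0 : 0 <= \sum_(i < N) nm (x i).
  by apply: sumr_ge0 => *; exact: ratnorm_ge0.
have := hN n N leNn (leqnn N); have := ratnorm_ge0 p_pr (x N).
by rewrite ge_max => h0 h1; apply/andP; split; lra.
Qed.

Definition cauchy_pred (_ : prime p) : {pred nat -> rat} :=
  fun x => `[< padic_cauchy x >].

Lemma cauchy_subring : subring_closed (cauchy_pred p_pr).
Proof.
split=> [|x y /asboolP hx /asboolP hy|x y /asboolP hx /asboolP hy];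
  apply/asboolP.
- by move=> e e0; exists 0%N => m n _ _; rewrite subrr ratnorm0.
- move=> e e0; have [N hN] := hx _ e0; have [M hM] := hy _ e0.
  exists (maxn N M) => m n; rewrite !geq_max => /andP[? ?] /andP[? ?].
  have -> : (x - y) m - (x - y) n = (x m - x n) + (y n - y m).
    by rewrite !fctE; ring.
  by rewrite ratnorm_lt ?hN ?hM.
- have [B B0 hB] := padic_cauchy_bounded hx.
  have [C C0 hC] := padic_cauchy_bounded hy.
  move=> e e0; have [N hN] := hx _ (divr_gt0 e0 C0).
  have [M hM] := hy _ (divr_gt0 e0 B0).
  exists (maxn N M) => m n; rewrite !geq_max => /andP[? ?] /andP[? ?].
  have -> : (x * y) m - (x * y) n = (x m - x n) * y m + x n * (y m - y n).
    by rewrite !fctE; ring.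
  rewrite ratnorm_lt // ratnormM //.
    apply: le_lt_trans (_ : nm (x m - x n) * C < e).
      by rewrite ler_wpM2l ?ratnorm_ge0.
    by rewrite -ltr_pdivlMr ?hN.
  apply: le_lt_trans (_ : B * nm (y m - y n) < e).
    by rewrite ler_wpM2r ?ratnorm_ge0.
  by rewrite mulrC -ltr_pdivlMr ?hM.
Qed.

HB.instance Definition _ :=
  GRing.isSubringClosed.Build (nat -> rat) (cauchy_pred p_pr) cauchy_subring.

Record cauchy_seq := CauchySeq {
  cseq :> nat -> rat; _ : cseq \in cauchy_pred p_pr }.

HB.instance Definition _ := [isSub for cseq].
HB.instance Definition _ := [Choice of cauchy_seq by <:].
HB.instance Definition _ := [SubChoice_isSubComNzRing of cauchy_seq by <:].

Lemma cauchy_seqP (u : cauchy_seq) : padic_cauchy u.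
Proof. by case: u => x hx; apply/asboolP. Qed.

Lemma cseq_sub (u v : cauchy_seq) n : (u - v) n = u n - v n.
Proof. by rewrite /GRing.add /=. Qed.

Lemma cseq_mul (u v : cauchy_seq) n : (u * v) n = u n * v n.
Proof. by rewrite /GRing.mul /=. Qed.

Lemma cseq_one n : (1 : cauchy_seq) n = 1.
Proof. by []. Qed.

Definition null_pred : {pred cauchy_seq} := fun u => `[< padic_null u >].

Lemma null_idealr : idealr_closed null_pred.
Proof.
split.
- by apply/asboolP => e e0; exists 0%N => n _; rewrite ratnorm0.
- apply/negP => /asboolP /(_ 1 ltr01)[N /(_ N (leqnn N))].
  by rewrite ratnorm1 // ltxx.
- move=> a u v /asboolP hu /asboolP hv; apply/asboolP => e e0.
  have [B B0 hB] := padic_cauchy_bounded (cauchy_seqP a).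
  have [N hN] := hu _ (divr_gt0 e0 B0); have [M hM] := hv _ e0.
  exists (maxn N M) => n; rewrite geq_max => /andP[? ?].
  rewrite ratnorm_lt ?hM // ratnormM //.
  apply: le_lt_trans (_ : B * nm (u n) < e).
    by rewrite ler_wpM2r ?ratnorm_ge0.
  by rewrite mulrC -ltr_pdivlMr ?hN.
Qed.

HB.instance Definition _ := isIdealr.Build cauchy_seq null_pred null_idealr.

Lemma nonnull_stable (u : cauchy_seq) : u \notin null_pred ->
  exists2 r, 0 < r & exists N, forall n, (N <= n)%N -> nm (u n) = r.
Proof.
move=> /asboolP /existsNP[e /not_implyP[e0 /forallNP he]].
have [N hN] := cauchy_seqP u e0.
have /existsNP[k /not_implyP[Nk /negP]] := he N; rewrite -leNgt => hk.
exists (nm (u k)); first exact: lt_le_trans hk.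
exists N => n Nn; apply: ratnorm_stable => //; apply: lt_le_trans hk.
exact: hN.
Qed.

Definition inv_seq (u : cauchy_seq) : nat -> rat :=
  if u \in null_pred then 0 else fun n => (u n)^-1.

Lemma inv_seq_cauchy u : inv_seq u \in cauchy_pred p_pr.
Proof.
rewrite /inv_seq; case: ifPn => [_|hu]; first exact: rpred0.
have [r r0 [N hN]] := nonnull_stable hu.
apply/asboolP => e e0.
have [M hM] := cauchy_seqP u (mulr_gt0 e0 (mulr_gt0 r0 r0)).
exists (maxn N M) => m n; rewrite !geq_max => /andP[Nm Mm] /andP[Nn Mn].
have um : u m != 0 by rewrite -(ratnorm_eq0 p_pr) hN // gt_eqF.
have un : u n != 0 by rewrite -(ratnorm_eq0 p_pr) hN // gt_eqF.
have -> : (u m)^-1 - (u n)^-1 = (u n - u m) / (u m * u n).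
  by field; rewrite um un.
rewrite ratnormM // ratnormV // ratnormM // !hN //.
by rewrite ltr_pdivrMr ?mulr_gt0 // hM.
Qed.

(* The completion of the rationals for the p-adic absolute value: Cauchy
   sequences modulo null sequences. *)
Definition Qp : Type := {ideal_quot null_pred}.

HB.instance Definition _ := GRing.ComNzRing.on Qp.

Definition Qp_of_seq (u : cauchy_seq) : Qp := \pi_{ideal_quot null_pred} u.
Definition Qp_inv (a : Qp) : Qp := Qp_of_seq (CauchySeq (inv_seq_cauchy (repr a))).

Lemma Qp_of_seqB u v : Qp_of_seq (u - v) = Qp_of_seq u - Qp_of_seq v.
Proof. by rewrite /Qp_of_seq !piE. Qed.

Lemma Qp_of_seqD u v : Qp_of_seq (u + v) = Qp_of_seq u + Qp_of_seq v.
Proof. by rewrite /Qp_of_seq !piE. Qed.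

Lemma Qp_of_seqM u v : Qp_of_seq (u * v) = Qp_of_seq u * Qp_of_seq v.
Proof. by rewrite /Qp_of_seq !piE. Qed.

Lemma Qp_of_seq0 : Qp_of_seq 0 = 0.
Proof. by rewrite /Qp_of_seq !piE. Qed.

Lemma Qp_of_seq1 : Qp_of_seq 1 = 1.
Proof. by rewrite /Qp_of_seq !piE. Qed.

Lemma Qp_of_seqK (a : Qp) : Qp_of_seq (repr a) = a.
Proof. exact: reprK. Qed.

Lemma Qp_of_seq_eq u v : (Qp_of_seq u == Qp_of_seq v) = (u - v \in null_pred).
Proof. by rewrite Quotient.idealrBE. Qed.

Lemma Qp_of_seq_eq0 u : (Qp_of_seq u == 0) = (u \in null_pred).
Proof. by rewrite -Qp_of_seq0 Qp_of_seq_eq subr0. Qed.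

Lemma Qp_mulVf (a : Qp) : a != 0 -> Qp_inv a * a = 1.
Proof.
rewrite -{1 3}[a]Qp_of_seqK /Qp_inv Qp_of_seq_eq0 => hu.
apply/eqP; rewrite -Qp_of_seqM -Qp_of_seq1 Qp_of_seq_eq.
have [r r0 [N hN]] := nonnull_stable hu.
apply/asboolP => e e0; exists N => n Nn.
rewrite cseq_sub cseq_mul cseq_one [CauchySeq _ _]/= /inv_seq (negPf hu) mulVf.
  by rewrite subrr ratnorm0.
by rewrite -(ratnorm_eq0 p_pr) hN // gt_eqF.
Qed.

Lemma Qp_invr0 : Qp_inv 0 = 0.
Proof.
have h0 : repr (0 : Qp) \in null_pred by rewrite -Qp_of_seq_eq0 Qp_of_seqK.
apply/eqP; rewrite /Qp_inv Qp_of_seq_eq0; apply/asboolP => e e0.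
by exists 0%N => n _ /=; rewrite /inv_seq h0 ratnorm0.
Qed.

HB.instance Definition _ :=
  GRing.ComNzRing_isField.Build Qp Qp_mulVf Qp_invr0.

(* The limit of |x_n|_p for a sequence x representing a; it is rational because
   |x_n|_p is eventually constant unless a = 0. *)
Definition Qp_norm (a : Qp) : rat :=
  xget 0 [set r | forall e : rat, 0 < e ->
    exists N, forall n, (N <= n)%N -> `|nm (repr a n) - r| < e]%classic.

Lemma Qp_norm_lim (u : cauchy_seq) r :
  (forall e : rat, 0 < e ->
     exists N, forall n, (N <= n)%N -> `|nm (u n) - r| < e) ->
  Qp_norm (Qp_of_seq u) = r.
Proof.
move=> hu; rewrite /Qp_norm; set v := repr _.
have hv : u - v \in null_pred by rewrite -Qp_of_seq_eq Qp_of_seqK.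
have {}hv e : 0 < e ->
    exists N, forall n, (N <= n)%N -> `|nm (v n) - r| < e.
  move=> e0; have e2 : 0 < e / 2 by rewrite divr_gt0.
  have [N hN] := hu _ e2; have /asboolP /(_ _ e2)[M hM] := hv.
  exists (maxn N M) => n; rewrite geq_max => /andP[/hN {}hN /hM].
  rewrite cseq_sub => {}hM.
  have := ratnormD p_pr (u n - v n) (v n); rewrite subrK.
  have := ratnormD p_pr (v n - u n) (u n); rewrite subrK ratnorm_distC //.
  move: hN hM (ratnorm_ge0 p_pr (u n)) (ratnorm_ge0 p_pr (v n)).
  move: (ratnorm_ge0 p_pr (u n - v n)).
  rewrite !le_max !ltr_norml => h0 /andP[h1 h2] h3 h4 h5 /orP h6 /orP h7.
  by case: h6 => h6; case: h7 => h7; apply/andP; split; lra.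
case: xgetP => [s _ hs|/(_ r) //].
apply/eqP/negPn/negP => neq.
have d0 : 0 < `|s - r| / 2 by rewrite divr_gt0 ?normr_gt0 ?subr_eq0.
have [N hN] := hs _ d0; have [M hM] := hv _ d0.
have := hN _ (leq_maxl N M); have := hM _ (leq_maxr N M).
set t := nm _ => h1 h2.
have : `|s - r| <= `|t - r| + `|t - s|.
  rewrite (_ : s - r = (t - r) - (t - s)) ?ler_normB //; ring.
by lra.
Qed.

Lemma Qp_norm_stable (u : cauchy_seq) r N :
  (forall n, (N <= n)%N -> nm (u n) = r) -> Qp_norm (Qp_of_seq u) = r.
Proof.
move=> h; apply: Qp_norm_lim => e e0; exists N => n /h ->.
by rewrite subrr normr0.
Qed.

Lemma Qp_normP (a : Qp) : exists2 u, a = Qp_of_seq u &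
  exists N, forall n, (N <= n)%N -> nm (u n) = Qp_norm a.
Proof.
have [->|] := eqVneq a 0.
  exists 0; first by rewrite Qp_of_seq0.
  have h n : (0 <= n)%N -> nm ((0 : cauchy_seq) n) = 0 by rewrite ratnorm0.
  by exists 0%N => n _; rewrite -Qp_of_seq0 (Qp_norm_stable h) h.
rewrite -[a]Qp_of_seqK Qp_of_seq_eq0 => /nonnull_stable[r r0 [N hN]].
by exists (repr a) => //; exists N => n Nn; rewrite (Qp_norm_stable hN) hN.
Qed.

Lemma Qp_norm_ge0 a : 0 <= Qp_norm a.
Proof.
have [u _ [N /(_ N (leqnn N)) <-]] := Qp_normP a; exact: ratnorm_ge0.
Qed.

Lemma Qp_norm0 : Qp_norm 0 = 0.
Proof.
rewrite -Qp_of_seq0; apply: (@Qp_norm_stable _ _ 0%N) => n _.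
by rewrite ratnorm0.
Qed.

Lemma Qp_norm_eq0 a : (Qp_norm a == 0) = (a == 0).
Proof.
apply/eqP/eqP => [a0|->]; last exact: Qp_norm0.
have [u ua [N hN]] := Qp_normP a; apply/eqP; rewrite ua Qp_of_seq_eq0.
by apply/asboolP => e e0; exists N => n /hN ->; rewrite a0.
Qed.

Lemma Qp_normM a b : Qp_norm (a * b) = Qp_norm a * Qp_norm b.
Proof.
have [u ua [N hN]] := Qp_normP a; have [v vb [M hM]] := Qp_normP b.
have -> : a * b = Qp_of_seq (u * v) by rewrite Qp_of_seqM -ua -vb.
apply: (@Qp_norm_stable _ _ (maxn N M)) => n.
by rewrite geq_max => /andP[/hN <- /hM <-]; exact: ratnormM.
Qed.

Lemma Qp_norm1 : Qp_norm 1 = 1.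
Proof.
rewrite -Qp_of_seq1; apply: (@Qp_norm_stable _ _ 0%N) => n _.
exact: ratnorm1.
Qed.

Lemma Qp_normN a : Qp_norm (- a) = Qp_norm a.
Proof.
rewrite -mulN1r Qp_normM (_ : Qp_norm (-1) = 1) ?mul1r //.
rewrite -sub0r -Qp_of_seq0 -Qp_of_seq1 -Qp_of_seqB.
apply: (@Qp_norm_stable _ _ 0%N) => n _.
by rewrite cseq_sub /= sub0r ratnormN ratnorm1.
Qed.

Lemma Qp_normD a b : Qp_norm (a + b) <= Num.max (Qp_norm a) (Qp_norm b).
Proof.
have [u ua [N hN]] := Qp_normP a; have [v vb [M hM]] := Qp_normP b.
have [->|] := eqVneq (a + b) 0.
  by rewrite Qp_norm0 le_max Qp_norm_ge0.
have -> : a + b = Qp_of_seq (u + v) by rewrite Qp_of_seqD -ua -vb.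
rewrite Qp_of_seq_eq0.
move=> /nonnull_stable[r r0 [L hL]]; rewrite (Qp_norm_stable hL).
pose n := maxn L (maxn N M).
rewrite -(hL n) ?leq_maxl // -(hN n) -?(hM n) ?leq_max ?leqnn ?orbT //.
exact: ratnormD.
Qed.

Definition Qp_dist (a b : Qp) : rat := Qp_norm (a - b).

Lemma Qp_dist_ge0 a b : 0 <= Qp_dist a b.
Proof. exact: Qp_norm_ge0. Qed.

Lemma Qp_distxx a : Qp_dist a a = 0.
Proof. by rewrite /Qp_dist subrr Qp_norm0. Qed.

Lemma Qp_dist_eq a b : Qp_dist a b = 0 -> a = b.
Proof. by move=> /eqP; rewrite Qp_norm_eq0 subr_eq0 => /eqP. Qed.

Lemma Qp_dist_sym a b : Qp_dist a b = Qp_dist b a.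
Proof. by rewrite /Qp_dist -opprB Qp_normN. Qed.

Lemma Qp_dist_triangle b a c : Qp_dist a c <= Qp_dist a b + Qp_dist b c.
Proof.
have := Qp_normD (a - b) (b - c); rewrite addrA subrK => /le_trans; apply.
by rewrite ge_max lerDl lerDr !Qp_norm_ge0.
Qed.

End Cauchy.

Lemma Qp_norm_nat (p : nat) (p_pr : prime p) (n : nat) :
  Qp_norm (n%:R : Qp p_pr) = ratnorm p n%:R.
Proof.
have h m k : (m%:R : cauchy_seq p_pr) k = m%:R.
  by elim: m => // m IH; rewrite -!natr1 -IH.
have -> : n%:R = Qp_of_seq (n%:R : cauchy_seq p_pr).
  elim: n => [|n IH]; first by rewrite Qp_of_seq0.
  by rewrite -!natr1 IH Qp_of_seqD Qp_of_seq1.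
by apply: (@Qp_norm_stable _ _ _ _ 0%N) => k _; rewrite h.
Qed.

HB.instance Definition _ (p : nat) (p_pr : prime p) :=
  isMetric.Build rat (Qp p_pr) (@Qp_distxx p p_pr) (@Qp_dist_eq p p_pr)
    (@Qp_dist_sym p p_pr) (@Qp_dist_triangle p p_pr).

Lemma Qp_cvgP (p : nat) (p_pr : prime p) (u : nat -> Qp p_pr) (a : Qp p_pr) :
  (u @ \oo --> a)%classic <->
  forall e : rat, 0 < e ->
    exists N, forall n, (N <= n)%N -> Qp_norm (u n - a) < e.
Proof.
split=> [ua e e0|h].
  have /ua [N _ hN] : nbhs a (ball a e) by exact: nbhsx_ballx.
  by exists N => n /hN; rewrite /= ballEmdist /= metric_sym.
move=> A /nbhs_ballP[e /= e0 eA]; have [N hN] := h _ e0.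
by exists N => // n /= /hN nN; apply: eA; rewrite ballEmdist /= metric_sym.
Qed.

Lemma prime_two : prime 2. Proof. by []. Qed.

Notation Q2 := (Qp prime_two).

Local Open Scope classical_set_scope.

Definition E2 : set Q2 := [set x | Qp_norm (x - 1) < 1 / 2].

Section PottsBethe.
Implicit Types (theta q x : Q2) (k n : nat).

Definition xinfty theta q : Q2 := 2 - theta - q.

Definition potts_bethe theta q k x : option Q2 :=
  if x == xinfty theta q then None
  else Some (((theta * x + q - 1) / (x + theta + q - 2)) ^+ k).

Definition cubic theta q : {poly Q2} :=
  'X^3 - (1 + theta + theta ^+ 2) *: 'X^2
  - ((2 * theta + 1) * (1 - theta - q)) *: 'X - ((1 - theta - q) ^+ 2)%:P.

(* When |theta - 1| < |q| < 1 the cubic has exactly one root in Q2; the default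
   value 0 is never a root then, since 1 - theta - q != 0. *)
Definition y1 theta q : Q2 := xget 0 [set y | root (cubic theta q) y].

Definition x1 theta q : Q2 := 1 - q + (theta - 1) * (y1 theta q - 1).

End PottsBethe.

Section PartialDynamics.
Implicit Type f : Q2 -> option Q2.

(* None as soon as the orbit leaves the domain of f. *)
Definition iterate f n (x : Q2) : option Q2 := iter n (obind f) (Some x).

Definition iter_preimage f n (S : set Q2) : set Q2 :=
  [set x | exists2 y, iterate f n x = Some y & S y].

Definition basin f (a : Q2) : set Q2 :=
  [set x | exists2 u : nat -> Q2,
    forall n, iterate f n x = Some (u n) & u @ \oo --> a].

End PartialDynamics.

(* Main.v *)
(* Put z = x - 1, t = theta - 1, s = z + t + q and w = t z / s, so that
   f(x) = (1 + w)^3.  In Q_2 one has |(1 + w)^3 - 1| = |w| for |w| < 1, which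
   gives |f(x) - 1| = |t/q| |z| when |z| < |q| and |f(x) - 1| = |t| < |q| when
   |z| > |q|: an orbit leaving the sphere |z| = |q| converges to 1.  An orbit
   remaining on this sphere satisfies |s| = |t| throughout, and there f expands
   distances by the factor |q/t| > 1, so there is at most one such orbit.  It is
   that of the fixed point x1, which exists because the cubic has a root: the
   cubic reads y = A + B/y + C/y^2 with |A| = 1 and |B|, |C| <= |q| < 1, a
   contraction of the unit sphere of the complete field Q_2. *)
Require Import Defs.
From mathcomp Require Import all_boot all_order all_algebra.
From mathcomp Require Import boolp classical_sets functions topology.
From mathcomp Require Import ring lra zify.

Import Order.TTheory GRing.Theory Num.Theory.
Local Open Scope ring_scope.
Local Open Scope classical_set_scope.

(** * Growth and decay of geometric sequences of rationals *)

Lemma bernoulli (d : rat) n : 0 <= d -> 1 + n%:R * d <= (1 + d) ^+ n.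
Proof.
move=> d0; elim: n => [|n IH]; first by rewrite mul0r addr0 expr0.
rewrite exprS; apply: (@le_trans _ _ ((1 + d) * (1 + n%:R * d))).
  rewrite -natr1; have : 0 <= n%:R * d * d by rewrite !mulr_ge0.
  lra.
by rewrite ler_wpM2l // addr_ge0.
Qed.

Lemma expr_unbounded (r B : rat) :
  1 < r -> exists N, forall n, (N <= n)%N -> B < r ^+ n.
Proof.
move=> r1; have d0 : 0 < r - 1 by rewrite subr_gt0.
exists (Num.bound (B / (r - 1))) => n hn.
have h := bernoulli (r - 1) n (ltW d0).
rewrite (addrC 1 (r - 1)) subrK in h; apply: lt_le_trans h.
(* The Archimedean bound is available for nonnegative arguments only, so a negative [B] is treated
   apart. *)
have [B0|B0] := ltP B 0.
  by apply: (lt_trans B0); rewrite ltr_pwDl // mulr_ge0 // ltW.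
have : B / (r - 1) < n%:R.
  apply: (@lt_le_trans _ _ (Num.bound (B / (r - 1)))%:R); last by rewrite ler_nat.
  by apply: archi_boundP; rewrite divr_ge0 // ltW.
rewrite ltr_pdivrMr // => h; lra.
Qed.

Lemma expr_small (r e : rat) : 0 <= r -> r < 1 -> 0 < e ->
  exists N, forall n, (N <= n)%N -> r ^+ n < e.
Proof.
rewrite le_eqVlt => /orP[/eqP <- _ e0|r0 r1 e0].
  (* For [r = 0] the tail starts at 1, because [0 ^+ 0] is 1. *)
  by exists 1%N => -[//|n] _; rewrite exprS mul0r.
have r1' : 1 < r^-1 by rewrite invf_gt1.
have [N hN] := expr_unbounded _ e^-1 r1'.
exists N => n /hN; rewrite exprVn ltf_pV2 // posrE ?exprn_gt0 //.
Qed.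

(** * Ultrametric norm, completeness and fixed points in the p-adic numbers *)

Section Padic.
Variables (p : nat) (p_pr : prime p).
Implicit Types (a b c : Qp p_pr) (u : cauchy_seq p_pr).
Local Notation N := (@Qp_norm p p_pr).

Lemma Qp_norm_gt0 a : (0 < N a) = (a != 0).
Proof. by rewrite lt_neqAle Qp_norm_ge0 andbT eq_sym Qp_norm_eq0. Qed.

Lemma Qp_normX a n : N (a ^+ n) = N a ^+ n.
Proof.
by elim: n => [|n IH]; rewrite ?expr0 ?Qp_norm1 // !exprS Qp_normM IH.
Qed.

Lemma Qp_normV a : N a^-1 = (N a)^-1.
Proof.
have [->|a0] := eqVneq a 0; first by rewrite !(invr0, Qp_norm0).
apply: (@mulfI _ (N a)); first by rewrite Qp_norm_eq0.
by rewrite -Qp_normM !divff ?Qp_norm_eq0 // Qp_norm1.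
Qed.

Lemma Qp_normD_le a b e : N a <= e -> N b <= e -> N (a + b) <= e.
Proof. by move=> ha hb; apply: le_trans (Qp_normD a b) _; rewrite ge_max ha. Qed.

Lemma Qp_normD_lt a b e : N a < e -> N b < e -> N (a + b) < e.
Proof. by move=> ha hb; apply: le_lt_trans (Qp_normD a b) _; rewrite gt_max ha. Qed.

Lemma Qp_norm_dom a b : N b < N a -> N (a + b) = N a.
Proof.
move=> h; apply/eqP; rewrite eq_le Qp_normD_le ?(ltW h) //=.
have := Qp_normD (a + b) (- b); rewrite addrK Qp_normN le_max => /orP[//|].
by rewrite leNgt h.
Qed.

Lemma Qp_norm_domr a b : N a < N b -> N (a + b) = N b.
Proof. by rewrite addrC; exact: Qp_norm_dom. Qed.

Lemma Qp_norm_nat_le1 n : N n%:R <= 1.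
Proof.
elim: n => [|n IH]; first by rewrite Qp_norm0.
by rewrite -natr1 Qp_normD_le // Qp_norm1.
Qed.

(** The norm of a class is 0 for a null sequence, and otherwise the value at which the norms of the
    terms become constant. *)
Lemma Qp_of_seq_norm_le u (e : rat) :
  (exists M, forall n, (M <= n)%N -> ratnorm p (u n) <= e) ->
  N (Qp_of_seq u) <= e.
Proof.
move=> [M hM]; have [hu|hu] := boolP (u \in @null_pred p p_pr).
  have /eqP -> : Qp_of_seq u == 0 by rewrite Qp_of_seq_eq0.
  by rewrite Qp_norm0; apply: le_trans (hM M (leqnn _)); exact: ratnorm_ge0.
have [r r0 [K hK]] := nonnull_stable hu.
rewrite (Qp_norm_stable hK) -(hK (maxn M K)) ?leq_maxr //.
exact/hM/leq_maxl.
Qed.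

Lemma const_cauchy (r : rat) : (fun=> r) \in cauchy_pred p_pr.
Proof. by apply/asboolP => e e0; exists 0%N => m n _ _; rewrite subrr ratnorm0. Qed.

Definition Qp_of_rat (r : rat) : Qp p_pr := Qp_of_seq (CauchySeq (const_cauchy r)).

Lemma Qp_of_rat_normB (r s : rat) : N (Qp_of_rat r - Qp_of_rat s) = ratnorm p (r - s).
Proof.
by rewrite -Qp_of_seqB; apply: (@Qp_norm_stable _ _ _ _ 0%N) => n _; rewrite cseq_sub.
Qed.

Lemma Qp_of_rat_dense a (e : rat) : 0 < e -> exists r, N (a - Qp_of_rat r) <= e.
Proof.
move=> e0; rewrite -(Qp_of_seqK a); move: (repr a) => u.
have [M hM] := cauchy_seqP u e0; exists (u M).
rewrite -Qp_of_seqB; apply: Qp_of_seq_norm_le; exists M => n Mn.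
by rewrite cseq_sub ltW // hM.
Qed.

(** Replacing each [a n] by a rational within [(1 / 2) ^+ n] gives a Cauchy sequence of rationals,
    and its class is the limit. *)
Lemma Qp_complete (a : nat -> Qp p_pr) :
  (forall e : rat, 0 < e ->
    exists M, forall m n, (M <= m)%N -> (M <= n)%N -> N (a m - a n) < e) ->
  exists b, forall e : rat, 0 < e ->
    exists M, forall n, (M <= n)%N -> N (a n - b) < e.
Proof.
move=> ha; have h2 : (0 : rat) < 1 / 2 by [].
have /choice[r hr] n : exists r, N (a n - Qp_of_rat r) <= (1 / 2) ^+ n.
  by apply: Qp_of_rat_dense; rewrite exprn_gt0.
have hd (e : rat) : 0 < e -> exists M, forall n, (M <= n)%N ->
    N (a n - Qp_of_rat (r n)) < e.
  move=> e0; have [M hM] := expr_small _ _ (ltW h2) (isT : (1 / 2 : rat) < 1) e0.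
  by exists M => n /hM; apply: le_lt_trans.
have rc : padic_cauchy p r.
  move=> e e0; have [M hM] := ha _ e0; have [K hK] := hd _ e0.
  exists (maxn M K) => m n; rewrite !geq_max => /andP[Mm Km] /andP[Mn Kn].
  rewrite -Qp_of_rat_normB.
  have -> : Qp_of_rat (r m) - Qp_of_rat (r n) = (a m - a n) +
     ((a n - Qp_of_rat (r n)) + - (a m - Qp_of_rat (r m))) by ring.
  by apply: Qp_normD_lt; [exact: hM | apply: Qp_normD_lt; rewrite ?Qp_normN hK].
have rc' : r \in cauchy_pred p_pr by apply/asboolP.
exists (Qp_of_seq (CauchySeq rc')) => e e0.
have [M hM] := hd _ e0; have [K hK] := rc _ (divr_gt0 e0 (isT : (0 : rat) < 2)).
exists (maxn M K) => n; rewrite !geq_max => /andP[Mn Kn].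
rewrite -[a n](subrK (Qp_of_rat (r n))) -addrA Qp_normD_lt ?hM //.
(* Passing to the class yields only a weak inequality, hence the margin [e / 2]. *)
rewrite -Qp_of_seqB; apply: (@le_lt_trans _ _ (e / 2)); last by lra.
apply: Qp_of_seq_norm_le; exists K => k Kk.
by rewrite cseq_sub ltW // hK.
Qed.

(** Banach's argument, iterating from 1. By the ultrametric inequality the bound [r ^+ n] on one
    step also bounds all later displacements, and a limit of points of norm 1 again has norm 1. *)
Lemma sphere_contraction (phi : Qp p_pr -> Qp p_pr) (r : rat) :
  0 <= r -> r < 1 ->
  (forall a, N a = 1 -> N (phi a) = 1) ->
  (forall a b, N a = 1 -> N b = 1 -> N (phi a - phi b) <= r * N (a - b)) ->
  exists2 a, N a = 1 & phi a = a.
Proof.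
move=> r0 r1 phi1 phiB; pose a n := iter n phi 1.
have a1 n : N (a n) = 1 by elim: n => [|n IH]; [exact: Qp_norm1 | exact: phi1].
have step n : N (a n.+1 - a n) <= r ^+ n.
  elim: n => [|n IH].
    by rewrite expr0 Qp_normD_le ?Qp_normN ?a1.
  apply: (le_trans (phiB _ _ (a1 n.+1) (a1 n))).
  by rewrite exprS ler_wpM2l.
have far n k : N (a (n + k)%N - a n) <= r ^+ n.
  elim: k => [|k IH]; first by rewrite addn0 subrr Qp_norm0 exprn_ge0.
  rewrite -(subrK (a (n + k)%N) (a (n + k.+1)%N)) -addrA Qp_normD_le //.
  rewrite addnS (le_trans (step _)) // exprD ler_piMr ?exprn_ge0 //.
  by rewrite exprn_ile1 // ltW.
have [|b hb] := Qp_complete a.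
  move=> e e0; have [M hM] := expr_small _ _ r0 r1 e0.
  exists M => m n Mm Mn; rewrite -(subrK (a M) (a m)) -addrA Qp_normD_lt //.
    by rewrite -(subnKC Mm); apply: le_lt_trans (far _ _) _; exact: hM.
  rewrite -opprB Qp_normN -(subnKC Mn).
  by apply: le_lt_trans (far _ _) _; exact: hM.
have b1 : N b = 1.
  have [M hM] := hb 1 ltr01.
  rewrite -(subrK (a M) b) Qp_norm_domr a1 // -opprB Qp_normN; exact: hM.
exists b => //; apply/eqP; rewrite -subr_eq0 -Qp_norm_eq0.
(* A positive [N (phi b - b)], used itself as the tolerance, would be smaller than itself. *)
rewrite eq_le Qp_norm_ge0 andbT leNgt; apply/negP => d0.
have [M hM] := hb _ d0.
have : N (phi b - b) < N (phi b - b).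
  rewrite -{1}(subrK (a M.+1) (phi b)) -addrA Qp_normD_lt ?hM //.
  apply: le_lt_trans (phiB _ _ b1 (a1 M)) _; rewrite -opprB Qp_normN.
  by apply: le_lt_trans (hM M _) => //; rewrite ler_piMl ?Qp_norm_ge0 // ltW.
by rewrite ltxx.
Qed.

End Padic.

(** * The residue field of the 2-adic numbers *)

Lemma Q2_norm3 : @Qp_norm 2 prime_two 3 = 1.
Proof. by rewrite Qp_norm_nat. Qed.

(** The residue field has two elements: a rational of norm 1 is a quotient of odd integers, and the
    difference of two odd integers is even. *)
Lemma Q2_norm_unit (w : Q2) : Qp_norm w = 1 -> Qp_norm (w - 1) < 1.
Proof.
have [u -> [M hM]] := Qp_normP w => w1; rewrite w1 in hM.
(* A strict bound may be lost in the limit; the terms satisfy the stronger bound [1 / 2]. *)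
apply: (@le_lt_trans _ _ (1 / 2)) => //.
rewrite -Qp_of_seq1 -Qp_of_seqB; apply: Qp_of_seq_norm_le; exists M => n Mn.
rewrite cseq_sub cseq_one; have := hM n Mn; move: (u n) => x {hM Mn}.
have [->|] := eqVneq (x - 1) 0; first by rewrite ratnorm0.
rewrite /ratnorm => x1; rewrite (negPf x1).
case: eqVneq => // x0 h.
have lv : ratval 2 x = 0.
  by apply: oppr_inj; apply: (@ieexprIz rat 2) => //; rewrite h oppr0 expr0z.
have n0 : numq x != 0 by rewrite numq_eq0.
have d0 := denq_neq0 x.
(* Valuation 0 makes the two exponents of 2 equal, and coprimality forbids both to be positive. *)
have odd_den : logn 2 `|denq x| = 0%N.
  apply/eqP; rewrite -leqn0 leqNgt; apply/negP => dd.
  have dn : (0 < logn 2 `|numq x|)%N by move: lv; rewrite /ratval; lia.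
  have := coprime_num_den x; rewrite /coprime => /eqP g1.
  have : (2 %| gcdn `|numq x| `|denq x|)%N.
    by rewrite dvdn_gcd -(expn1 2) !pfactor_dvdn ?absz_gt0 ?dn.
  by rewrite g1.
have odd_num : logn 2 `|numq x| = 0%N by move: lv; rewrite /ratval; lia.
have e : x - 1 = (numq x - denq x)%:~R / (denq x)%:~R.
  by rewrite rmorphB mulrBl divq_num_den divff // intr_eq0.
have nd0 : numq x - denq x != 0.
  by apply: contraNneq x1; rewrite e => ->; rewrite mul0r.
rewrite e ratval_frac // odd_den subr0.
have -> : 1 / 2 = 2%:R ^ (-1) :> rat by [].
rewrite ler_eXz2l //.
have : (0 < logn 2 `|(numq x - denq x)%R|)%N.
  have odd_of k : k != 0 -> logn 2 `|k| = 0%N -> odd `|k|.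
    move=> k0 lk; rewrite -[odd _]negbK -dvdn2.
    by rewrite -(expn1 2) pfactor_dvdn ?absz_gt0 // lk.
  rewrite -pfactor_dvdn ?absz_gt0 // expn1 dvdn2.
  have := odd_of _ n0 odd_num; have := odd_of _ d0 odd_den; lia.
lia.
Qed.

(** * Algebraic identities for the map and the cubic *)

Section FieldIdentities.
Variable K : fieldType.
Implicit Types theta q x y a b c : K.

Lemma potts_betheB1 theta q x (s := x - (2 - theta - q)) : s != 0 ->
  (theta * x + q - 1) / (x + theta + q - 2) = 1 + (theta - 1) * (x - 1) / s.
Proof.
move=> s0; have -> : x + theta + q - 2 = s by rewrite /s; ring.
by rewrite -[X in X + _ / _](divff s0) -mulrDl; congr (_ / _); rewrite /s; ring.
Qed.

Lemma moebiusB a b x y : x + b != 0 -> y + b != 0 ->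
  a * x / (x + b) - a * y / (y + b) = a * b * (x - y) / ((x + b) * (y + b)).
Proof. by move=> x0 y0; field; rewrite x0 y0. Qed.

Lemma laurentB a b c x y : x != 0 -> y != 0 ->
  (a + (b / x + c / x ^+ 2)) - (a + (b / y + c / y ^+ 2)) =
  (b + c * ((x + y) / (x * y))) * ((y - x) / (x * y)).
Proof. by move=> x0 y0; field; rewrite x0 y0. Qed.

Lemma cubic_laurent a b c y : y != 0 ->
  y ^+ 3 - a * y ^+ 2 - b * y - c = y ^+ 2 * (y - (a + (b / y + c / y ^+ 2))).
Proof. by move=> y0; field. Qed.

(** At the point [x1] built from [y], the denominator [s] equals [t * y]; this is the base of the
    cube there. *)
Lemma potts_bethe_at_root theta q y (t := theta - 1) : t != 0 -> y != 0 ->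
  1 + t * (1 - q + t * (y - 1) - 1) / (t * y) = (theta * y + (1 - theta - q)) / y.
Proof. by rewrite /t => t0 y0; field; rewrite t0 y0. Qed.

End FieldIdentities.

(** * Cubing near 1 in the 2-adic numbers *)

Local Notation N := (@Qp_norm 2 prime_two).

(** The cofactor of [a - b] is 3 plus terms of norm below 1, and 3 is a 2-adic unit. *)
Lemma Q2_cubeB (a b : Q2) : N a < 1 -> N b < 1 ->
  N ((1 + a) ^+ 3 - (1 + b) ^+ 3) = N (a - b).
Proof.
move=> a1 b1.
have -> : (1 + a) ^+ 3 - (1 + b) ^+ 3 =
  (a - b) * (3 + ((3 + a) * a + (3 + a + b) * b)) by ring.
have h3 x : N x < 1 -> N (3 + x) = 1 by move=> ?; rewrite Qp_norm_dom Q2_norm3.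
have h y x : N y = 1 -> N x < 1 -> N (y * x) < 1.
  by move=> y1 x1; rewrite Qp_normM y1 mul1r.
rewrite Qp_normM h3 ?mulr1 // Qp_normD_lt // h ?h3 //.
by rewrite -addrA h3 // Qp_normD_lt.
Qed.

Lemma Q2_cubeB1_lt1 (w : Q2) : N w < 1 -> N ((1 + w) ^+ 3 - 1) = N w.
Proof.
move=> w1; have := Q2_cubeB w 0 w1; rewrite Qp_norm0 addr0 expr1n subr0.
exact.
Qed.

(* For [|w| = 1] the residue class of [w] is 1, and [w^2 + 3 w + 3] is a unit. *)
Lemma Q2_cubeB1_ge1 (w : Q2) : 1 <= N w -> 1 <= N ((1 + w) ^+ 3 - 1).
Proof.
rewrite le_eqVlt => /orP[/eqP w1|w1].
  have v1 := Q2_norm_unit w (esym w1).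
  have -> : (1 + w) ^+ 3 - 1 =
    w * (1 + (2 * 3 + 2 * (w - 1) + (3 + (w - 1)) * (w - 1))) by ring.
  have n2 : N 2 < 1 by rewrite Qp_norm_nat.
  rewrite Qp_normM -w1 mul1r Qp_norm_dom Qp_norm1 //.
  apply: Qp_normD_lt; first apply: Qp_normD_lt; rewrite Qp_normM.
  - by rewrite Q2_norm3 mulr1.
  - by rewrite mulr_ilt1 ?Qp_norm_ge0.
  - by rewrite (Qp_norm_dom _ _ 3) Q2_norm3 ?mul1r.
have -> : (1 + w) ^+ 3 - 1 = w * (w ^+ 2 + (3 * w + 3)) by ring.
have w0 : 0 < N w by apply: lt_trans w1.
have w2 : N w < N (w ^+ 2) by rewrite Qp_normX expr2 ltr_pMr.
rewrite Qp_normM Qp_norm_dom.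
  apply: (@le_trans _ _ (N w)); first exact: ltW.
  by rewrite ler_pMr // Qp_normX ltW // exprn_egt1.
apply: Qp_normD_lt; first by rewrite Qp_normM Q2_norm3 mul1r.
by rewrite Q2_norm3; apply: lt_trans w2.
Qed.

(** * Dynamics inside, outside and on the sphere of radius [N q] about 1 *)

Section Dynamics.
Variables theta q : Q2.
Hypothesis t_gt0 : 0 < N (theta - 1).
Hypothesis t_lt_q : N (theta - 1) < N q.
Hypothesis q_lt1 : N q < 1.

Let t := theta - 1.
Let s (x : Q2) := x - xinfty theta q.
Let w (x : Q2) := t * (x - 1) / s x.
(** A total map: since the inverse of 0 is 0, it sends [xinfty] to 1, so it represents [potts_bethe]
    only away from the pole. *)
Let F (x : Q2) := (1 + w x) ^+ 3.

Lemma s_eq0 x : (s x == 0) = (x == xinfty theta q).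
Proof. by rewrite subr_eq0. Qed.

Lemma potts_betheE x : x != xinfty theta q -> potts_bethe theta q 3 x = Some (F x).
Proof.
move=> xi; rewrite /potts_bethe (negPf xi); congr (Some (_ ^+ 3)).
by apply: potts_betheB1; rewrite s_eq0.
Qed.

Lemma sE x : s x = (x - 1) + (t + q).
Proof. by rewrite /s /t /xinfty; ring. Qed.

Lemma norm_tq : N (t + q) = N q.
Proof. exact: Qp_norm_domr. Qed.

Lemma t_lt1 : N t < 1. Proof. exact: lt_trans q_lt1. Qed.

Lemma q_gt0 : 0 < N q. Proof. exact: lt_trans t_lt_q. Qed.

Lemma norm_w x : N (w x) = N t * N (x - 1) / N (s x).
Proof. by rewrite /w !(Qp_normM, Qp_normV). Qed.

Lemma F_near x : N (x - 1) < N q -> N (F x - 1) = N t / N q * N (x - 1).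
Proof.
move=> xq.
have sx : N (s x) = N q by rewrite sE Qp_norm_domr norm_tq.
have wx : N (w x) = N t / N q * N (x - 1) by rewrite norm_w sx mulrAC.
rewrite Q2_cubeB1_lt1 ?wx //.
rewrite mulrAC ltr_pdivrMr ?q_gt0 // mul1r.
apply: le_lt_trans xq; rewrite ler_piMl ?Qp_norm_ge0 //; exact/ltW/t_lt1.
Qed.

Lemma F_far x : N q < N (x - 1) -> N (F x - 1) = N t.
Proof.
move=> qx.
have sx : N (s x) = N (x - 1) by rewrite sE Qp_norm_dom // norm_tq.
have wx : N (w x) = N t.
  by rewrite norm_w sx mulfK // gt_eqF // (lt_trans q_gt0).
by rewrite Q2_cubeB1_lt1 wx ?t_lt1.
Qed.

(** If [w x] had norm at least 1, so would [F x - 1], although [N q < 1]. Hence cubing preserves the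
    norm of [w x], and [N t * N q / N (s x) = N q]. *)
Lemma F_sphere x : N (x - 1) = N q -> N (F x - 1) = N q -> N (s x) = N t.
Proof.
move=> xq Fq.
have w1 : N (w x) < 1.
  rewrite ltNge; apply/negP => /Q2_cubeB1_ge1.
  by rewrite -/(F x) Fq leNgt q_lt1.
move: Fq; rewrite Q2_cubeB1_lt1 // norm_w xq => e.
have q0 := q_gt0.
(* At the pole the convention on inverses would give [N q = 0]. *)
have s0 : N (s x) != 0.
  by apply/eqP => s0; move: e; rewrite s0 invr0 mulr0 => e; rewrite -e ltxx in q0.
have /divr1_eq -> // : N t / N (s x) = 1.
by apply: (mulIf (lt0r_neq0 q0)); rewrite mul1r mulrAC.
Qed.

(** Both [w x] and [w y] have norm [N q < 1], so cubing is isometric on them, and the expansion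
    comes from the factor [t * (t + q) / (s x * s y)] of the Moebius difference. *)
Lemma F_expand x y : N (s x) = N t -> N (s y) = N t ->
  N (F x - F y) = N q / N t * N (x - y).
Proof.
move=> sx sy.
have w_lt1 z : N (s z) = N t -> N (w z) < 1.
  move=> sz; rewrite norm_w sz mulrAC divff ?gt_eqF // mul1r.
  have -> : z - 1 = s z - (t + q) by rewrite sE addrK.
  by rewrite Qp_norm_domr Qp_normN norm_tq // sz.
have s0 z : N (s z) = N t -> s z != 0.
  by rewrite -Qp_norm_eq0 => ->; rewrite gt_eqF.
rewrite Q2_cubeB ?w_lt1 //.
have -> : w x - w y = t * (t + q) * (x - y) / (s x * s y).
  have := s0 _ sy; have := s0 _ sx; rewrite /w !sE => x0 y0.
  rewrite moebiusB //; congr (_ * _ / _); ring.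
rewrite !(Qp_normM, Qp_normV) sx sy norm_tq; field.
by rewrite gt_eqF.
Qed.

Lemma near_cvg x : N (x - 1) < N q -> forall e : rat, 0 < e ->
  exists M, forall n, (M <= n)%N -> N (iter n F x - 1) < e.
Proof.
move=> xq e e0; have q0 := q_gt0.
have r0 : 0 <= N t / N q by rewrite divr_ge0 ?Qp_norm_ge0.
have r1 : N t / N q < 1 by rewrite ltr_pdivrMr // mul1r.
have h n : N (iter n F x - 1) = (N t / N q) ^+ n * N (x - 1).
  elim: n => [|n IH]; first by rewrite expr0 mul1r.
  rewrite iterS F_near IH ?exprS ?mulrA //.
  by apply: le_lt_trans xq; rewrite ler_piMl ?Qp_norm_ge0 ?exprn_ile1 // ltW.
have [M hM] := expr_small _ _ r0 r1 e0; exists M => n Mn; rewrite h.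
apply: le_lt_trans (hM n Mn); rewrite ler_piMr ?exprn_ge0 //.
by rewrite ltW // (lt_trans xq).
Qed.

(** A point inside the sphere is attracted at once; a point outside lands at distance [N t < N q]
    from 1 after one more step. *)
Lemma off_sphere_cvg x n : N (iter n F x - 1) != N q -> forall e : rat, 0 < e ->
  exists M, forall k, (M <= k)%N -> N (iter k F x - 1) < e.
Proof.
move=> off e e0.
have [m mq] : exists m, N (iter m F x - 1) < N q.
  move: off; rewrite neq_lt => /orP[|/F_far h]; first by exists n.
  by exists n.+1; rewrite iterS h.
have [M hM] := near_cvg _ mq _ e0; exists (M + m)%N => k Mk.
rewrite -(subnK (leq_trans (leq_addl M m) Mk)) iterD hM //.
by rewrite leq_subRL ?(leq_trans (leq_addl M m) Mk) // addnC.
Qed.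

Lemma on_sphere_unique x y :
  (forall n, N (iter n F x - 1) = N q) -> (forall n, N (iter n F y - 1) = N q) ->
  x = y.
Proof.
move=> hx hy; apply/eqP; rewrite -subr_eq0 -Qp_norm_eq0; apply: contraT => xy.
have {}xy : 0 < N (x - y) by rewrite lt_neqAle eq_sym xy Qp_norm_ge0.
have h n : N (iter n F x - iter n F y) = (N q / N t) ^+ n * N (x - y).
  elim: n => [|n IH]; first by rewrite expr0 mul1r.
  rewrite !iterS F_expand ?IH ?exprS ?mulrA //.
    by apply: F_sphere => //; exact: (hx n.+1).
  by apply: F_sphere => //; exact: (hy n.+1).
have r1 : 1 < N q / N t by rewrite ltr_pdivlMr // mul1r.
(* This threshold pushes the distance of the two orbits beyond [N q], the largest distance between
   points of the sphere. *)
have [M /(_ M (leqnn M)) hM] := expr_unbounded _ (N q / N (x - y)) r1.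
rewrite ltr_pdivrMr // -h ltNge in hM; case/negP: hM.
rewrite (_ : iter M F x - _ = iter M F x - 1 + - (iter M F y - 1)); last by ring.
by rewrite Qp_normD_le ?Qp_normN ?hx ?hy.
Qed.

(** * Coefficients and roots of the cubic *)

Let c := 1 - theta - q.
Let A := 1 + theta + theta ^+ 2.
Let B := (2 * theta + 1) * c.

Lemma norm_c : N c = N q.
Proof. by rewrite -norm_tq -Qp_normN /c /t; congr (N _); ring. Qed.

Lemma norm_A : N A = 1.
Proof.
have -> : A = 3 + (3 + t) * t by rewrite /A /t; ring.
rewrite Qp_norm_dom Q2_norm3 // Qp_normM (Qp_norm_dom _ _ 3) Q2_norm3 ?mul1r //;
  exact: t_lt1.
Qed.

Lemma norm_B : N B <= N q.
Proof.
rewrite Qp_normM norm_c ler_piMl ?Qp_norm_ge0 //.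
have -> : 2 * theta + 1 = 3 + 2 * t by rewrite /t; ring.
apply: Qp_normD_le; first by rewrite Q2_norm3.
by rewrite Qp_normM mulr_ile1 ?Qp_norm_ge0 ?Qp_norm_nat_le1 // ltW // t_lt1.
Qed.

Lemma norm_C : N (c ^+ 2) <= N q.
Proof. by rewrite Qp_normX norm_c expr2 ler_piMl ?Qp_norm_ge0 // ltW. Qed.

Lemma root_cubicE y :
  root (cubic theta q) y = (y ^+ 3 - A * y ^+ 2 - B * y - c ^+ 2 == 0).
Proof. by rewrite rootE /cubic !(hornerE, hornerXn). Qed.

Lemma cubic_has_root : exists y, root (cubic theta q) y.
Proof.
(* On the unit sphere a fixed point of [phi] is a root; the contraction ratio is [N q], which bounds
   the norms of [B] and [c ^+ 2]. *)
pose phi y := A + (B / y + c ^+ 2 / y ^+ 2).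
have q0 := ltW q_gt0.
have [||y y1 fy] := sphere_contraction _ _ phi _ q0 q_lt1.
- move=> a a1; rewrite Qp_norm_dom norm_A //.
  apply: le_lt_trans q_lt1; apply: Qp_normD_le.
    by rewrite Qp_normM Qp_normV a1 invr1 mulr1 norm_B.
  by rewrite Qp_normM Qp_normV (Qp_normX _ _ a) a1 expr1n invr1 mulr1 norm_C.
- move=> a b a1 b1.
  have a0 : a != 0 by rewrite -Qp_norm_eq0 a1.
  have b0 : b != 0 by rewrite -Qp_norm_eq0 b1.
  have -> : phi a - phi b = (B + c ^+ 2 * ((a + b) / (a * b))) * ((b - a) / (a * b)).
    exact: laurentB.
  rewrite Qp_normM; have -> : N ((b - a) / (a * b)) = N (a - b).
    by rewrite -(opprB a b) Qp_normM Qp_normV Qp_normN Qp_normM a1 b1 mulr1 invr1 mulr1.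
  rewrite ler_wpM2r ?Qp_norm_ge0 // Qp_normD_le ?norm_B //.
  rewrite Qp_normM; apply: le_trans norm_C; rewrite ler_piMr ?Qp_norm_ge0 //.
  by rewrite Qp_normM Qp_normV Qp_normM a1 b1 mulr1 invr1 mulr1 Qp_normD_le ?a1 ?b1.
exists y; have y0 : y != 0 by rewrite -Qp_norm_eq0 y1.
rewrite root_cubicE.
have -> : y ^+ 3 - A * y ^+ 2 - B * y - c ^+ 2 = y ^+ 2 * (y - phi y).
  exact: cubic_laurent.
by rewrite fy subrr mulr0.
Qed.

(** Once a root exists, [xget] returns a root instead of its default. *)
Lemma y1_root : root (cubic theta q) (y1 theta q).
Proof.
have [y hy] := cubic_has_root; rewrite /y1.
by case: xgetP => [z _ hz|/(_ y)]; [exact: hz | case/(_ hy)].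
Qed.

Lemma root_cubic_neq0 y : root (cubic theta q) y -> y != 0.
Proof.
apply: contraTneq => ->; rewrite root_cubicE !expr0n /= !mulr0 !subr0 sub0r oppr_eq0.
by rewrite expf_eq0 /= -Qp_norm_eq0 norm_c gt_eqF // q_gt0.
Qed.

(** Equality would mean [x1 = 1]. It forces [N y = N q / N t > 1], and then [y ^+ 3] dominates every
    other term of the cubic. *)
Lemma root_cubic_neq y : root (cubic theta q) y -> t * y != t + q.
Proof.
rewrite root_cubicE => /eqP e; apply/eqP => ty.
have t0 : t != 0 by rewrite -Qp_norm_gt0.
have y_gt1 : 1 < N y.
  by rewrite -(ltr_pM2l t_gt0) mulr1 -Qp_normM ty norm_tq.
have y3 : y ^+ 3 = A * y ^+ 2 + (B * y + c ^+ 2).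
  by apply/eqP; rewrite -subr_eq0 -e; apply/eqP; ring.
have : N (y ^+ 3) <= N y ^+ 2.
  have q1 := ltW q_lt1; have y1 := ltW y_gt1.
  rewrite y3; apply: Qp_normD_le; first by rewrite Qp_normM norm_A mul1r Qp_normX.
  have yy : N y <= N y ^+ 2 by rewrite expr2 ler_peMr ?Qp_norm_ge0.
  apply: Qp_normD_le.
    apply: le_trans yy; rewrite Qp_normM ler_piMl ?Qp_norm_ge0 //.
    exact: le_trans norm_B q1.
  apply: le_trans norm_C _; apply: le_trans q1 _; exact: le_trans yy.
by rewrite Qp_normX leNgt ltr_eXn2l.
Qed.

(** * The fixed point [x1] *)

Lemma s_x1 : s (x1 theta q) = t * y1 theta q.
Proof. by rewrite /s /x1 /xinfty /t; ring. Qed.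

Lemma x1_neq_xinfty : x1 theta q != xinfty theta q.
Proof.
rewrite -s_eq0 s_x1; apply: mulf_neq0; first by rewrite -Qp_norm_gt0.
exact: root_cubic_neq0 y1_root.
Qed.

Lemma x1_neq1 : x1 theta q != 1.
Proof.
have := root_cubic_neq _ y1_root; rewrite -s_x1 sE -subr_eq0 addrK.
by rewrite subr_eq0.
Qed.

(** Multiplied by [y ^+ 3], the fixed-point equation is [- (t * y + c)] times the cubic; the linear
    factor belongs to the fixed point 1. *)
Lemma F_x1 : F (x1 theta q) = x1 theta q.
Proof.
have y0 := root_cubic_neq0 _ y1_root.
have t0 : t != 0 by rewrite -Qp_norm_gt0.
have := y1_root; rewrite root_cubicE /F /w s_x1 /x1; set y := y1 theta q in y0 *.
move=> /eqP e.
have -> : 1 + t * (1 - q + (theta - 1) * (y - 1) - 1) / (t * y) = (theta * y + c) / y.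
  exact: potts_bethe_at_root.
rewrite expr_div_n; apply: (mulIf (expf_neq0 3 y0)); rewrite divfK ?expf_neq0 //.
apply/eqP; rewrite -subr_eq0; apply/eqP.
rewrite -[RHS](mulr0 (- (t * y + c))) -e /A /B /c /t; ring.
Qed.

Lemma iterF_x1 n : iter n F (x1 theta q) = x1 theta q.
Proof. by elim: n => // n IH; rewrite iterS IH F_x1. Qed.

(** Off the sphere the constant orbit of [x1] would converge to 1, but [x1] differs from 1. *)
Lemma x1_on_sphere n : N (iter n F (x1 theta q) - 1) = N q.
Proof.
apply/eqP; apply: contraT => /off_sphere_cvg h.
have d0 : 0 < N (x1 theta q - 1) by rewrite Qp_norm_gt0 subr_eq0 x1_neq1.
by have [M /(_ M (leqnn M))] := h _ d0; rewrite iterF_x1 ltxx.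
Qed.

(** * From the total map back to the partial one, and the basin *)

Lemma iterate_avoid x :
  (forall n, ~ iter_preimage (potts_bethe theta q 3) n [set xinfty theta q] x) ->
  forall n, iterate (potts_bethe theta q 3) n x = Some (iter n F x).
Proof.
move=> av; elim=> [//|n IH]; rewrite /iterate iterS -/(iterate _ n x) IH /=.
apply: potts_betheE; apply/eqP => e; apply: (av n).
by exists (iter n F x).
Qed.

Lemma basinE : basin (potts_bethe theta q 3) 1 =
  [set: Q2] `\` ([set x1 theta q] `|`
    \bigcup_n iter_preimage (potts_bethe theta q 3) n [set xinfty theta q]).
Proof.
apply/seteqP; split=> x.
  move=> [u hu /Qp_cvgP u1]; split=> // -[/= xe|[n _ [y yn /= yi]]].
    have d0 : 0 < N (x1 theta q - 1) by rewrite Qp_norm_gt0 subr_eq0 x1_neq1.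
    have [M /(_ M (leqnn M))] := u1 _ d0.
    suff -> : u M = x1 theta q by rewrite ltxx.
    have h n : iterate (potts_bethe theta q 3) n x = Some (x1 theta q).
      elim: n => [|n IH]; first by rewrite xe.
      rewrite /iterate iterS -/(iterate _ n x) IH /=.
      by rewrite potts_betheE ?x1_neq_xinfty // F_x1.
    by have := hu M; rewrite h => -[].
  (* An orbit at the pole at time [n] is undefined at time [n.+1]. *)
  have := hu n.+1; rewrite /iterate iterS -/(iterate _ n x) yn /= yi.
  by rewrite /potts_bethe eqxx.
move=> [_ /not_orP[/= xx1 /= av]].
have {}av n : ~ iter_preimage (potts_bethe theta q 3) n [set xinfty theta q] x.
  by move=> h; apply: av; exists n.
exists (fun n => iter n F x); first exact: iterate_avoid.
(* An orbit that never leaves the sphere is that of [x1], which is excluded; any other orbit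
   converges to 1. *)
apply/Qp_cvgP; have [on|] := pselect (forall n, N (iter n F x - 1) = N q).
  by case: xx1; apply: on_sphere_unique => // n; exact: x1_on_sphere.
by move=> /existsNP[n /eqP] /off_sphere_cvg.
Qed.

End Dynamics.

Theorem theorem5p15 (theta q : Q2)
    (theta_E2 : E2 theta)
    (theta_neq1 : 0 < Qp_norm (theta - 1))
    (theta_lt_q : Qp_norm (theta - 1) < Qp_norm q)
    (q_lt1 : Qp_norm q < 1) :
  basin (potts_bethe theta q 3) 1 =
  [set: Q2] `\` ([set x1 theta q] `|`
    \bigcup_n iter_preimage (potts_bethe theta q 3) n [set xinfty theta q]).
Proof. exact (basinE theta q theta_neq1 theta_lt_q q_lt1). Qed.
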